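(* Let $P$ be an arbitrary set, let $\mathcal{DS}^{co}$ be the category of the cocartesian monoidal comonad freely generated by $P$ as set of generating objects, and let $\mathit{Rel}$ be the category of all binary relations between finite ordinals. Then the functor $G:\mathcal{DS}^{co}\to\mathit{Rel}$ defined in the context is faithful; i.e. for all objects $A,B$ and all arrows $f,g:A\to B$ of $\mathcal{DS}^{co}$, if $Gf=Gg$, then $f=g$.
   Context: A cocartesian category is a (symmetric) monoidal category whose monoidal structure is given by finite coproducts: $\otimes$ is binary coproduct, $I$ is the initial object, and $a_{A,B,C}:(A\otimes B)\otimes C\to A\otimes(B\otimes C)$, $l_A:I\otimes A\to A$, $r_A:A\otimes I\to A$, $c_{A,B}:A\otimes B\to B\otimes A$ are the canonical isomorphisms. $\nabla_A:A\otimes A\to A$ is the codiagonal, $!_A:I\to A$ is the unique arrow from the initial object, and the injections are $\iota^1_{A,B}=(\mathbf 1_A\otimes !_B)\circ r_A^{-1}:A\to A\otimes B$ and $\iota^2_{A,B}=(!_A\otimes\mathbf 1_B)\circ l_B^{-1}:B\to A\otimes B$. $\mathbf 1_A$ denotes the identity arrow of $A$. A cocartesian monoidal comonad is a cocartesian category together with a comonad $\langle L,\varepsilon,\delta\rangle$ in it (with $\varepsilon_A:LA\to A$, $\delta_A:LA\to LLA$). One then defines $\psi_{A,B}=\nabla_{L(A\otimes B)}\circ(L\iota^1_{A,B}\otimes L\iota^2_{A,B}):LA\otimes LB\to L(A\otimes B)$ and $\psi_0={!_{LI}}:I\to LI$. (Equivalently: a symmetric monoidal comonad in a cocartesian category,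 i.e. a comonad whose endofunctor is symmetric monoidal via $\psi,\psi_0$ and whose $\varepsilon,\delta$ are monoidal natural transformations, such that $\psi$ satisfies the displayed equation.) $\mathcal{DS}^{co}$ is the free such structure on $P$: its objects are the formal expressions built from elements of $P$ (propositional letters) and $I$ by $\otimes$ and $L$; its arrows are arrow terms built from identities, $a,a^{-1},l,l^{-1},r,r^{-1},c,\nabla,!,\varepsilon,\delta$ (and $\psi,\psi_0$) by $\circ$, $\otimes$ and $L$, modulo the congruence generated by the equations of categories, functoriality, naturality, finite coproducts, comonads, and the equations above. $\mathit{Rel}$ has as objects the finite ordinals $n=\{0,\dots,n-1\}$ and as arrows $n\to m$ all relations $R\subseteq n\times m$, with the usual composition of relations. The functor $G$: $GA$ is the number of occurrences of propositional letters in $A$ plus the number of occurrences of $L$ in $A$ (occurrences of $I$ are not counted); the elements $0,\dots,GA-1$ of $GA$ correspond to these occurrences counted from right to left in $A$. On arrow terms: $G$ of an identity and of $a_{A,B,C}$, $l_A$, $r_A$ and their inverses is the identity relation; $Gc_{A,B}$ is the bijection sending every occurrence in $A$, respectively $B$, in the source $A\otimes B$ to the corresponding occurrence in $A$, respectively $B$, in the target $B\otimes A$; $G\nabla_A$ relates every occurrence in either copy of $A$ in $A\otimes A$ to the corresponding occurrence in the target $A$; $G!_A$ is the empty relation from $\emptyset$ to $GA$; $G\psi_{A,B}$ relates both the occurrence of $L$ in front of $A$ and the occurrence of $L$ in front of $B$ in the source $LA\otimes LB$ to the outermost occurrence of $L$ in the target $L(A\otimes B)$, and relates every counted occurrence inside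 $A$, respectively inside $B$, to the corresponding occurrence inside $A$, respectively $B$ (and nothing else is related); $G\psi_0$ is the empty relation from $0=\emptyset$ to $1=\{\emptyset\}$; $G\varepsilon_A\subseteq(GA+1)\times GA$ is $\{(i,i)\mid i<GA\}$; $G\delta_A\subseteq(GA+1)\times(GA+2)$ is $\{(i,i)\mid i\le GA\}\cup\{(GA,GA+1)\}$; $G(f\otimes g)$ is the juxtaposition of $Gf$ (on the left, i.e. on the larger elements) and $Gg$ (on the right, i.e. on the smaller elements); $GLf$ extends $Gf$ by relating the new leftmost (greatest) element of the source to the new leftmost (greatest) element of the target; $G(g\circ f)=Gg\circ Gf$. *)

(* Defs.v *)
From mathcomp Require Import all_boot zify.
From Corelib Require Import RelationClasses.

Set Implicit Arguments.
Unset Strict Implicit.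
Unset Printing Implicit Defensive.

(** * Categories with an equivalence relation on arrows, and functors *)

Record category := Category {
  ob :> Type;
  hom : ob -> ob -> Type;
  (* [heq] is the equality of arrows of the category. *)
  heq : forall A B, hom A B -> hom A B -> Prop;
  idm : forall A, hom A A;
  comp : forall A B C, hom B C -> hom A B -> hom A C;
  heq_equiv : forall A B, Equivalence (@heq A B);
  comp_heq : forall A B C (g g' : hom B C) (f f' : hom A B),
    heq g g' -> heq f f' -> heq (comp g f) (comp g' f');
  comp_idl : forall A B (f : hom A B), heq (comp (idm B) f) f;
  comp_idr : forall A B (f : hom A B), heq (comp f (idm A)) f;
  comp_assoc : forall A B C D (h : hom C D) (g : hom B C) (f : hom A B),
    heq (comp h (comp g f)) (comp (comp h g) f)
}.

Arguments hom {c} A B.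
Arguments heq {c A B} f g.
Arguments idm {c} A.
Arguments comp {c A B C} g f.

Record functor (C D : category) := Functor {
  fob :> C -> D;
  fhom : forall A B : C, hom A B -> hom (fob A) (fob B);
  fhom_heq : forall (A B : C) (f g : hom A B),
    heq f g -> heq (fhom f) (fhom g);
  fhom_id : forall A : C, heq (fhom (idm A)) (idm (fob A));
  fhom_comp : forall (A B E : C) (g : hom B E) (f : hom A B),
    heq (fhom (comp g f)) (comp (fhom g) (fhom f))
}.

Arguments fhom {C D} f {A B} _ : rename.

Definition faithful (C D : category) (F : functor C D) : Prop :=
  forall (A B : C) (f g : hom A B), heq (fhom F f) (fhom F g) -> heq f g.

(** * Objects and arrow terms of the free cocartesian monoidal comonad *)

Inductive obj (P : Type) : Type :=
  | letter of P
  | unitO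
  | tensO of obj P & obj P
  | LO of obj P.

Arguments unitO {P}.

Declare Scope dsobj_scope.
Delimit Scope dsobj_scope with dsobj.
Bind Scope dsobj_scope with obj.
Notation "A ⊗ B" := (tensO A B) (at level 40, left associativity) : dsobj_scope.

Inductive arr (P : Type) : obj P -> obj P -> Type :=
  | idA A : arr A A
  | compA A B C : arr B C -> arr A B -> arr A C
  | tensA A A' B B' : arr A A' -> arr B B' -> arr (A ⊗ B) (A' ⊗ B')
  | LA A B : arr A B -> arr (LO A) (LO B)
  | assoc A B C : arr ((A ⊗ B) ⊗ C) (A ⊗ (B ⊗ C))
  | assocV A B C : arr (A ⊗ (B ⊗ C)) ((A ⊗ B) ⊗ C)
  | lunit A : arr (unitO ⊗ A) A
  | lunitV A : arr A (unitO ⊗ A)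
  | runit A : arr (A ⊗ unitO) A
  | runitV A : arr A (A ⊗ unitO)
  | swap A B : arr (A ⊗ B) (B ⊗ A)
  | codiag A : arr (A ⊗ A) A
  | initA A : arr unitO A
  | eps A : arr (LO A) A
  | delta A : arr (LO A) (LO (LO A))
  | psi A B : arr (LO A ⊗ LO B) (LO (A ⊗ B))
  | psi0 : arr unitO (LO unitO).

Arguments psi0 {P}.

Declare Scope dsarr_scope.
Delimit Scope dsarr_scope with dsarr.
Bind Scope dsarr_scope with arr.
Notation "g ∘ f" := (compA g f) (at level 50, left associativity) : dsarr_scope.
Notation "f ⊗ g" := (tensA f g) (at level 40, left associativity) : dsarr_scope.

Local Open Scope dsarr_scope.

Definition inj1 (P : Type) (A B : obj P) : arr A (A ⊗ B) :=
  (idA A ⊗ initA B) ∘ runitV A.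

Definition inj2 (P : Type) (A B : obj P) : arr B (A ⊗ B) :=
  (initA A ⊗ idA B) ∘ lunitV B.

Reserved Notation "f ≡ g" (at level 70, no associativity).

(* Equality of arrows. The triangular equations [eq_codiag_inj1],
   [eq_codiag_inj2], [eq_codiag_inj] together with the naturality of [codiag]
   and initiality of [unitO] say that [A ⊗ B] is a coproduct with injections
   [inj1], [inj2] and copairing [codiag C ∘ (f ⊗ g)]; the canonical
   isomorphisms are then given by their defining copairings, so that the
   coherence equations of symmetric monoidal categories are consequences. *)
Inductive eqA (P : Type) : forall A B : obj P, arr A B -> arr A B -> Prop :=
  (* congruence *)
  | eqA_refl A B (f : arr A B) : f ≡ f
  | eqA_sym A B (f g : arr A B) : f ≡ g -> g ≡ f
  | eqA_trans A B (f g h : arr A B) : f ≡ g -> g ≡ h -> f ≡ h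
  | eq_compA A B C (g g' : arr B C) (f f' : arr A B) :
      g ≡ g' -> f ≡ f' -> g ∘ f ≡ g' ∘ f'
  | eq_tensA A A' B B' (f f' : arr A A') (g g' : arr B B') :
      f ≡ f' -> g ≡ g' -> f ⊗ g ≡ f' ⊗ g'
  | eq_LA A B (f f' : arr A B) : f ≡ f' -> LA f ≡ LA f'
  (* category *)
  | eq_idl A B (f : arr A B) : idA B ∘ f ≡ f
  | eq_idr A B (f : arr A B) : f ∘ idA A ≡ f
  | eq_assoc A B C D (h : arr C D) (g : arr B C) (f : arr A B) :
      h ∘ (g ∘ f) ≡ (h ∘ g) ∘ f
  (* functoriality *)
  | eq_tens_id A B : idA A ⊗ idA B ≡ idA (A ⊗ B)
  | eq_tens_comp A A' A'' B B' B'' (f' : arr A' A'') (f : arr A A')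
      (g' : arr B' B'') (g : arr B B') :
      (f' ∘ f) ⊗ (g' ∘ g) ≡ (f' ⊗ g') ∘ (f ⊗ g)
  | eq_L_id A : LA (idA A) ≡ idA (LO A)
  | eq_L_comp A B C (g : arr B C) (f : arr A B) : LA (g ∘ f) ≡ LA g ∘ LA f
  (* isomorphisms *)
  | eq_assocK A B C : assocV A B C ∘ assoc A B C ≡ idA ((A ⊗ B) ⊗ C)
  | eq_assocVK A B C : assoc A B C ∘ assocV A B C ≡ idA (A ⊗ (B ⊗ C))
  | eq_lunitK A : lunitV A ∘ lunit A ≡ idA (unitO ⊗ A)
  | eq_lunitVK A : lunit A ∘ lunitV A ≡ idA A
  | eq_runitK A : runitV A ∘ runit A ≡ idA (A ⊗ unitO)
  | eq_runitVK A : runit A ∘ runitV A ≡ idA A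
  | eq_swapK A B : swap B A ∘ swap A B ≡ idA (A ⊗ B)
  (* naturality *)
  | nat_assoc A A' B B' C C' (f : arr A A') (g : arr B B') (h : arr C C') :
      (f ⊗ (g ⊗ h)) ∘ assoc A B C ≡ assoc A' B' C' ∘ ((f ⊗ g) ⊗ h)
  | nat_lunit A B (f : arr A B) :
      f ∘ lunit A ≡ lunit B ∘ (idA unitO ⊗ f)
  | nat_runit A B (f : arr A B) :
      f ∘ runit A ≡ runit B ∘ (f ⊗ idA unitO)
  | nat_swap A A' B B' (f : arr A A') (g : arr B B') :
      (g ⊗ f) ∘ swap A B ≡ swap A' B' ∘ (f ⊗ g)
  | nat_codiag A B (f : arr A B) : f ∘ codiag A ≡ codiag B ∘ (f ⊗ f)
  | nat_eps A B (f : arr A B) : f ∘ eps A ≡ eps B ∘ LA f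
  | nat_delta A B (f : arr A B) : LA (LA f) ∘ delta A ≡ delta B ∘ LA f
  (* finite coproducts *)
  | eq_initA A (f : arr unitO A) : f ≡ initA A
  | eq_codiag_inj1 A : codiag A ∘ inj1 A A ≡ idA A
  | eq_codiag_inj2 A : codiag A ∘ inj2 A A ≡ idA A
  | eq_codiag_inj A B :
      codiag (A ⊗ B) ∘ (inj1 A B ⊗ inj2 A B) ≡ idA (A ⊗ B)
  | eq_assoc_canonical A B C :
      assoc A B C ≡
        codiag (A ⊗ (B ⊗ C)) ∘
          ((codiag (A ⊗ (B ⊗ C)) ∘
             (inj1 A (B ⊗ C) ⊗ (inj2 A (B ⊗ C) ∘ inj1 B C)))
           ⊗ (inj2 A (B ⊗ C) ∘ inj2 B C))
  | eq_lunit_canonical A : lunit A ≡ codiag A ∘ (initA A ⊗ idA A)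
  | eq_runit_canonical A : runit A ≡ codiag A ∘ (idA A ⊗ initA A)
  | eq_swap_canonical A B :
      swap A B ≡ codiag (B ⊗ A) ∘ (inj2 B A ⊗ inj1 B A)
  (* comonad *)
  | eq_eps_delta A : eps (LO A) ∘ delta A ≡ idA (LO A)
  | eq_Leps_delta A : LA (eps A) ∘ delta A ≡ idA (LO A)
  | eq_delta_delta A : delta (LO A) ∘ delta A ≡ LA (delta A) ∘ delta A
  (* definition of [psi] and [psi0] *)
  | eq_psi A B :
      psi A B ≡ codiag (LO (A ⊗ B)) ∘ (LA (inj1 A B) ⊗ LA (inj2 A B))
  | eq_psi0 : psi0 ≡ initA (LO unitO)
where "f ≡ g" := (eqA f g).

Lemma eqA_equiv (P : Type) (A B : obj P) : Equivalence (@eqA P A B).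
Proof.
split; [exact: eqA_refl | exact: eqA_sym | move=> f g h; exact: eqA_trans].
Qed.

Definition DSco (P : Type) : category :=
  Category (@eqA_equiv P) (@eq_compA P) (@eq_idl P) (@eq_idr P) (@eq_assoc P).

(** * Relations between finite ordinals *)

Notation relation n m := {set 'I_n * 'I_m}.

(* [{(i, i) | i < n, i < m}]: the identity relation when [n = m], where [n] and
   [m] need not be convertible; for [n = m.+1], the image of the counit. *)
Definition rid (n m : nat) : relation n m :=
  [set p : 'I_n * 'I_m | p.1 == p.2 :> nat].

Definition rcomp (n m k : nat) (S : relation m k) (R : relation n m) :
    relation n k :=
  [set p : 'I_n * 'I_k | [exists j, ((p.1, j) \in R) && ((j, p.2) \in S)]].

(* Juxtaposition, with [R] on the larger and [S] on the smaller elements. *)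
Definition rtens (n m n' m' : nat) (R : relation n m) (S : relation n' m') :
    relation (n' + n) (m' + m) :=
  [set p : 'I_(n' + n) * 'I_(m' + m) |
    match split p.1, split p.2 with
    | inr i, inr j => (i, j) \in R
    | inl i, inl j => (i, j) \in S
    | _, _ => false
    end].

(* Adds one pair made of the two greatest elements. *)
Definition rL (n m : nat) (R : relation n m) : relation n.+1 m.+1 :=
  [set p : 'I_n.+1 * 'I_m.+1 |
    match unlift ord_max p.1, unlift ord_max p.2 with
    | Some i, Some j => (i, j) \in R
    | None, None => true
    | _, _ => false
    end].

Lemma rcomp_idl n m (R : relation n m) : rcomp (rid m m) R = R.
Proof.
apply/setP=> -[i j]; rewrite !inE; apply/existsP/idP => [[k]|Rij].
  by rewrite !inE /= => /andP[Rik /eqP/val_inj <-].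
by exists j; rewrite !inE /= Rij eqxx.
Qed.

Lemma rcomp_idr n m (R : relation n m) : rcomp R (rid n n) = R.
Proof.
apply/setP=> -[i j]; rewrite !inE; apply/existsP/idP => [[k]|Rij].
  by rewrite !inE /= => /andP[/eqP/val_inj <-].
by exists i; rewrite !inE /= Rij eqxx.
Qed.

Lemma rcompA n m k l (T : relation k l) (S : relation m k) (R : relation n m) :
  rcomp T (rcomp S R) = rcomp (rcomp T S) R.
Proof.
apply/setP=> -[i j]; rewrite !inE; apply/existsP/existsP => /= -[x].
  rewrite inE => /andP[/existsP[y /andP[H1 H2] H3]].
  by exists y; rewrite H1 inE; apply/existsP; exists x; rewrite H2.
rewrite !inE => /andP[H1 /existsP[y /andP[H2 H3]]].
by exists y; rewrite H3 inE andbT; apply/existsP; exists x; rewrite H1.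
Qed.

Lemma rcomp_eq n m k (S S' : relation m k) (R R' : relation n m) :
  S = S' -> R = R' -> rcomp S R = rcomp S' R'.
Proof. by move=> -> ->. Qed.

Definition Rel : category :=
  @Category nat (fun n m => relation n m) (fun n m R S => R = S)
    (fun n => rid n n) rcomp (fun n m => eq_equivalence) rcomp_eq
    rcomp_idl rcomp_idr rcompA.

(** * The functor G *)

(* Occurrences are counted from right to left, hence in [A ⊗ B] those of [B]
   are the first ones, and the outermost [L] of [LO A] is the last one. *)
Fixpoint Gob (P : Type) (A : obj P) : nat :=
  match A with
  | letter _ => 1
  | unitO => 0
  | tensO A B => Gob B + Gob A
  | LO A => (Gob A).+1
  end.

Definition rswap (n m : nat) : relation (m + n) (n + m) :=
  [set p : 'I_(m + n) * 'I_(n + m) |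
    match split p.1 with
    | inl i => p.2 == n + i :> nat
    | inr i => p.2 == i :> nat
    end].

Definition rcodiag (n : nat) : relation (n + n) n :=
  [set p : 'I_(n + n) * 'I_n |
    match split p.1 with
    | inl i => p.2 == i :> nat
    | inr i => p.2 == i :> nat
    end].

Definition rdelta (n : nat) : relation n.+1 n.+2 :=
  [set p : 'I_n.+1 * 'I_n.+2 |
    (p.1 == p.2 :> nat) || ((p.1 == n :> nat) && (p.2 == n.+1 :> nat))].

(* Here [n] and [m] are the values of [Gob] at [A] and [B]; in [LO A ⊗ LO B] the
   occurrences are those of [B], the second [L], those of [A], the first [L]. *)
Definition rpsi (n m : nat) : relation (m.+1 + n.+1) (m + n).+1 :=
  [set p : 'I_(m.+1 + n.+1) * 'I_(m + n).+1 |
    match split p.1 with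
    | inl i => if i == m :> nat then p.2 == m + n :> nat
               else p.2 == i :> nat
    | inr i => if i == n :> nat then p.2 == m + n :> nat
               else p.2 == m + i :> nat
    end].

Fixpoint Garr (P : Type) (A B : obj P) (f : arr A B) :
    relation (Gob A) (Gob B) :=
  match f in arr A B return relation (Gob A) (Gob B) with
  | idA A => rid (Gob A) (Gob A)
  | compA _ _ _ g f => rcomp (Garr g) (Garr f)
  | tensA _ _ _ _ f g => rtens (Garr f) (Garr g)
  | LA _ _ f => rL (Garr f)
  | assoc A B C => rid (Gob ((A ⊗ B) ⊗ C)) (Gob (A ⊗ (B ⊗ C)))
  | assocV A B C => rid (Gob (A ⊗ (B ⊗ C))) (Gob ((A ⊗ B) ⊗ C))
  | lunit A => rid (Gob (unitO ⊗ A)) (Gob A)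
  | lunitV A => rid (Gob A) (Gob (unitO ⊗ A))
  | runit A => rid (Gob (A ⊗ unitO)) (Gob A)
  | runitV A => rid (Gob A) (Gob (A ⊗ unitO))
  | swap A B => rswap (Gob A) (Gob B)
  | codiag A => rcodiag (Gob A)
  | initA A => set0
  | eps A => rid (Gob A).+1 (Gob A)
  | delta A => rdelta (Gob A)
  | psi A B => rpsi (Gob A) (Gob B)
  | psi0 => set0
  end.

(** * G is well defined on arrows and functorial *)

Lemma relP n m (R S : relation n m) :
  (forall i j, ((i, j) \in R) = ((i, j) \in S)) -> R = S.
Proof. by move=> H; apply/setP=> -[i j]. Qed.

Lemma mem_rel n m (R : relation n m) (i i' : 'I_n) (j j' : 'I_m) :
  i = i' :> nat -> j = j' :> nat -> ((i, j) \in R) = ((i', j') \in R).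
Proof. by move=> /val_inj -> /val_inj ->. Qed.

Lemma in_rid n m (i : 'I_n) (j : 'I_m) :
  ((i, j) \in rid n m) = (i == j :> nat).
Proof. by rewrite inE. Qed.

Lemma in_rcompP n m k (S : relation m k) (R : relation n m) i l :
  reflect (exists2 j, (i, j) \in R & (j, l) \in S) ((i, l) \in rcomp S R).
Proof.
rewrite inE; apply: (iffP existsP) => -[j]; first by case/andP; exists j.
by move=> H1 H2; exists j; rewrite H1.
Qed.

(* [R] is the graph of the restriction of [phi]. *)
Definition isf n m (R : relation n m) (phi : nat -> nat) :=
  (forall x, x < n -> phi x < m) /\
  (forall i j, ((i, j) \in R) = (j == phi i :> nat)).

Lemma isf_eq n m (R R' : relation n m) phi phi' :
  isf R phi -> isf R' phi' -> (forall x, x < n -> phi x = phi' x) -> R = R'.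
Proof. by move=> [_ H] [_ H'] E; apply: relP => i j; rewrite H H' E. Qed.

Lemma in_rcomp_isf n m k (S : relation m k) (R : relation n m) phi
    (H : isf R phi) i l :
  ((i, l) \in rcomp S R) = ((Ordinal (H.1 i (ltn_ord i)), l) \in S).
Proof.
apply/in_rcompP/idP => [[j]|Sl].
  by rewrite H.2 => /eqP E; congr (_ \in S); congr (_, _); apply: val_inj.
by exists (Ordinal (H.1 i (ltn_ord i))); rewrite ?H.2.
Qed.

Lemma isf_comp n m k (S : relation m k) (R : relation n m) phi chi :
  isf S chi -> isf R phi -> isf (rcomp S R) (fun x => chi (phi x)).
Proof.
move=> HS HR; split=> [x lx|i j]; first by apply: HS.1; apply: HR.1.
by rewrite (in_rcomp_isf _ HR) HS.2.
Qed.

Lemma in_rtens_ll n m n' m' (R : relation n m) (S : relation n' m') i j :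
  ((lshift _ i, lshift _ j) \in rtens R S) = ((i, j) \in S).
Proof. by rewrite inE /= !(unsplitK (inl _)). Qed.

Lemma in_rtens_rr n m n' m' (R : relation n m) (S : relation n' m') i j :
  ((rshift _ i, rshift _ j) \in rtens R S) = ((i, j) \in R).
Proof. by rewrite inE /= !(unsplitK (inr _)). Qed.

Lemma in_rtens_lr n m n' m' (R : relation n m) (S : relation n' m') i j :
  ((lshift _ i, rshift _ j) \in rtens R S) = false.
Proof. by rewrite inE /= (unsplitK (inl _)) (unsplitK (inr _)). Qed.

Lemma in_rtens_rl n m n' m' (R : relation n m) (S : relation n' m') i j :
  ((rshift _ i, lshift _ j) \in rtens R S) = false.
Proof. by rewrite inE /= (unsplitK (inl _)) (unsplitK (inr _)). Qed.

Definition in_rtens := (in_rtens_ll, in_rtens_rr, in_rtens_lr, in_rtens_rl).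

Lemma isf_tens n m n' m' (R : relation n m) (S : relation n' m') phi chi :
  isf R phi -> isf S chi ->
  isf (rtens R S) (fun x => if x < n' then chi x else m' + phi (x - n')).
Proof.
move=> HR HS; split=> [x lx|i j].
  case: (ltnP x n') => h; first by have := HS.1 x h; lia.
  by have := HR.1 (x - n') ltac:(lia); lia.
case: (split_ordP i) => i' ->; case: (split_ordP j) => j' ->;
  rewrite in_rtens /= ?HR.2 ?HS.2.
- by [].
- by have := HS.1 i' (ltn_ord i'); lia.
- by have := ltn_ord j'; lia.
- by rewrite addKn eqn_add2l.
Qed.

Lemma in_rL_ll n m (R : relation n m) i j :
  ((lift ord_max i, lift ord_max j) \in rL R) = ((i, j) \in R).
Proof. by rewrite inE /= !liftK. Qed.

Lemma in_rL_lm n m (R : relation n m) i :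
  ((lift ord_max i, ord_max) \in rL R) = false.
Proof. by rewrite inE /= liftK unlift_none. Qed.

Lemma in_rL_ml n m (R : relation n m) j :
  ((ord_max, lift ord_max j) \in rL R) = false.
Proof. by rewrite inE /= liftK unlift_none. Qed.

Lemma in_rL_mm n m (R : relation n m) : ((ord_max, ord_max) \in rL R) = true.
Proof. by rewrite inE /= !unlift_none. Qed.

Definition in_rL := (in_rL_ll, in_rL_lm, in_rL_ml, in_rL_mm).

Lemma bump_ord n (i : 'I_n) : bump n i = i.
Proof. by rewrite /bump leqNgt ltn_ord. Qed.

Lemma isf_L n m (R : relation n m) phi :
  isf R phi -> isf (rL R) (fun x => if x == n then m else phi x).
Proof.
move=> HR; split=> [x lx|i j].
  by case: (x =P n) => h; [lia|have := HR.1 x ltac:(lia); lia].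
case: (unliftP ord_max i) => [i'|] ->; case: (unliftP ord_max j) => [j'|] ->;
  rewrite in_rL /= ?HR.2 ?bump_ord ?eqxx ?(ltn_eqF (ltn_ord _)) //.
by rewrite gtn_eqF // HR.1.
Qed.

Lemma isf_rid n m : n <= m -> isf (rid n m) id.
Proof.
by move=> le; split=> [x|i j]; [lia|rewrite in_rid eq_sym].
Qed.

Lemma isf_set0 m : isf (set0 : relation 0 m) id.
Proof. by split=> // -[]. Qed.

Lemma isf_rswap n m :
  isf (rswap n m) (fun x => if x < m then n + x else x - m).
Proof.
split=> [x lx|i j]; first by repeat case: ifP; lia.
by rewrite inE /=; case: splitP => k ->; have := ltn_ord k; try case: ifP; lia.
Qed.

Lemma isf_rcodiag n : isf (rcodiag n) (fun x => if x < n then x else x - n).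
Proof.
split=> [x lx|i j]; first by repeat case: ifP; lia.
by rewrite inE /=; case: splitP => k ->; have := ltn_ord k; try case: ifP; lia.
Qed.

Lemma isf_rpsi n m :
  isf (rpsi n m) (fun x => if x < m then x else if x == m then m + n else x.-1).
Proof.
split=> [x lx|i j]; first by repeat case: ifP; lia.
rewrite inE /=; case: splitP => k ->; have := ltn_ord k; repeat case: ifP; lia.
Qed.

Lemma isf_inj1 (P : Type) (A B : obj P) :
  isf (Garr (inj1 A B)) (fun x => Gob B + x).
Proof.
have H := isf_comp (isf_tens (isf_rid (leqnn (Gob A))) (isf_set0 (Gob B)))
                   (isf_rid (leqnn (Gob A))).
by split=> [x lx|i j]; [have := H.1 x lx|rewrite H.2]; rewrite /= ?subn0.
Qed.

Lemma isf_inj2 (P : Type) (A B : obj P) : isf (Garr (inj2 A B)) id.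
Proof.
have le : Gob B <= Gob B + 0 by rewrite addn0.
have H := isf_comp (isf_tens (isf_set0 (Gob A)) (isf_rid (leqnn (Gob B))))
                   (isf_rid le).
split=> [x lx|i j]; first by have := H.1 x lx; rewrite lx.
by rewrite H.2 ltn_ord.
Qed.

Lemma in_rdelta n (i : 'I_n.+1) (j : 'I_n.+2) :
  ((i, j) \in rdelta n) = (i == minn j n :> nat).
Proof. by rewrite inE /=; have := ltn_ord i; have := ltn_ord j; lia. Qed.


Local Arguments inj1 : simpl never.
Local Arguments inj2 : simpl never.

Local Ltac solve_isf :=
  repeat first
    [ apply: isf_inj1 | apply: isf_inj2 | apply: isf_rswap | apply: isf_rcodiag
    | apply: isf_rpsi | apply: isf_set0 | apply: isf_comp | apply: isf_tens
    | apply: isf_L | (apply: isf_rid; rewrite /=; lia) ].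

Local Ltac case_if :=
  match goal with
  | |- context [if ?b then _ else _] =>
      lazymatch b with
      | context [if _ then _ else _] => fail
      | _ => let E := fresh "E" in case E: b
      end
  end.

Local Ltac solve_graph :=
  rewrite /=; eapply isf_eq; [solve_isf | solve_isf
  | let x := fresh "x" in move=> x /= ?; repeat case_if; lia ].

(* [R] is the converse of the graph of the restriction of [phi]. *)
Definition isb n m (R : relation n m) (phi : nat -> nat) :=
  (forall y, y < m -> phi y < n) /\
  (forall i j, ((i, j) \in R) = (i == phi j :> nat)).

Lemma isb_eq n m (R R' : relation n m) phi phi' :
  isb R phi -> isb R' phi' -> (forall y, y < m -> phi y = phi' y) -> R = R'.
Proof. by move=> [_ H] [_ H'] E; apply: relP => i j; rewrite H H' E. Qed.

Lemma in_rcomp_isb n m k (S : relation m k) (R : relation n m) phi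
    (H : isb S phi) i l :
  ((i, l) \in rcomp S R) = ((i, Ordinal (H.1 l (ltn_ord l))) \in R).
Proof.
apply/in_rcompP/idP => [[j Rj]|Rl].
  rewrite H.2 => /eqP E; move: Rj; congr (_ \in R); congr (_, _).
  exact: val_inj.
by exists (Ordinal (H.1 l (ltn_ord l))); rewrite ?H.2.
Qed.

Lemma isb_comp n m k (S : relation m k) (R : relation n m) phi chi :
  isb S chi -> isb R phi -> isb (rcomp S R) (fun x => phi (chi x)).
Proof.
move=> HS HR; split=> [x lx|i j]; first by apply: HR.1; apply: HS.1.
by rewrite (in_rcomp_isb _ HS) HR.2.
Qed.

Lemma isb_L n m (R : relation n m) phi :
  isb R phi -> isb (rL R) (fun y => if y == m then n else phi y).
Proof.
move=> HR; split=> [x lx|i j].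
  by case: (x =P m) => h; [lia|have := HR.1 x ltac:(lia); lia].
case: (unliftP ord_max i) => [i'|] ->; case: (unliftP ord_max j) => [j'|] ->;
  rewrite in_rL /= ?HR.2 ?bump_ord ?eqxx ?(ltn_eqF (ltn_ord _)) //.
by rewrite gtn_eqF // HR.1.
Qed.

Lemma isb_rid n m : m <= n -> isb (rid n m) id.
Proof. by move=> le; split=> [x|i j]; [lia|rewrite in_rid]. Qed.

Lemma isb_rdelta n : isb (rdelta n) (fun y => minn y n).
Proof. by split=> [y _|i j]; [lia|rewrite in_rdelta]. Qed.

Local Ltac solve_isb :=
  repeat first
    [ apply: isb_comp | apply: isb_rdelta | apply: isb_L
    | (apply: isb_rid; rewrite /=; lia) ].

Local Ltac solve_cograph :=
  rewrite /=; eapply isb_eq; [solve_isb | solve_isb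
  | let x := fresh "x" in move=> x /= ?; repeat case_if; lia ].

Lemma rtens_comp n m k n' m' k' (R' : relation m k) (R : relation n m)
    (S' : relation m' k') (S : relation n' m') :
  rtens (rcomp R' R) (rcomp S' S) = rcomp (rtens R' S') (rtens R S).
Proof.
apply: relP => i j; apply/idP/in_rcompP.
  case: (split_ordP i) => i' ->; case: (split_ordP j) => j' ->;
    rewrite in_rtens // => /in_rcompP[l H H'].
    by exists (lshift _ l); rewrite in_rtens.
  by exists (rshift _ l); rewrite in_rtens.
case=> l; case: (split_ordP i) => i' ->; case: (split_ordP j) => j' ->;
  case: (split_ordP l) => l' ->; rewrite !in_rtens // => H H';
  by apply/in_rcompP; exists l'.
Qed.

Lemma rL_comp n m k (S : relation m k) (R : relation n m) :
  rL (rcomp S R) = rcomp (rL S) (rL R).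
Proof.
apply: relP => i j; apply/idP/in_rcompP.
  case: (unliftP ord_max i) => [i'|] ->; case: (unliftP ord_max j) => [j'|] ->;
    rewrite in_rL //.
    by case/in_rcompP=> l H H'; exists (lift ord_max l); rewrite in_rL.
  by exists ord_max; rewrite in_rL.
case=> l; case: (unliftP ord_max i) => [i'|] ->;
  case: (unliftP ord_max j) => [j'|] ->; case: (unliftP ord_max l) => [l'|] ->;
  rewrite !in_rL // => H H'.
by apply/in_rcompP; exists l'.
Qed.

Lemma in_rtensA n1 m1 n2 m2 n3 m3 (R : relation n1 m1) (S : relation n2 m2)
    (T : relation n3 m3) (i : 'I_(n3 + n2 + n1)) (j : 'I_(m3 + m2 + m1))
    (i' : 'I_(n3 + (n2 + n1))) (j' : 'I_(m3 + (m2 + m1))) :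
  i = i' :> nat -> j = j' :> nat ->
  ((i, j) \in rtens R (rtens S T)) = ((i', j') \in rtens (rtens R S) T).
Proof.
case: (split_ordP i) => x ->; [case: (split_ordP x) => {}x -> | ];
  (case: (split_ordP i') => x' ->; [ | case: (split_ordP x') => {}x' ->]);
  rewrite /= => Ei; try (have := ltn_ord x; have := ltn_ord x'; lia);
  (case: (split_ordP j) => y ->; [case: (split_ordP y) => {}y -> | ]);
  (case: (split_ordP j') => y' ->; [ | case: (split_ordP y') => {}y' ->]);
  rewrite /= => Ej; try (have := ltn_ord y; have := ltn_ord y'; lia);
  rewrite !in_rtens //; apply: mem_rel; lia.
Qed.

Lemma in_rtens0 n m (R : relation n m) (i : 'I_(n + 0)) (j : 'I_(m + 0))
    (i' : 'I_n) (j' : 'I_m) :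
  i = i' :> nat -> j = j' :> nat ->
  ((i, j) \in rtens (rid 0 0) R) = ((i', j') \in R).
Proof.
case: (split_ordP i) => -[x hx] -> //; case: (split_ordP j) => -[y hy] -> //.
by move=> /= Ei Ej; rewrite in_rtens; apply: mem_rel.
Qed.

Lemma in_rtens1 n m (R : relation n m) (i : 'I_(0 + n)) (j : 'I_(0 + m))
    (i' : 'I_n) (j' : 'I_m) :
  i = i' :> nat -> j = j' :> nat ->
  ((i, j) \in rtens R (rid 0 0)) = ((i', j') \in R).
Proof.
case: (split_ordP i) => -[x hx] -> //; case: (split_ordP j) => -[y hy] -> //.
by move=> /= Ei Ej; rewrite in_rtens; apply: mem_rel.
Qed.

Lemma isb_rswap n m :
  isb (rswap n m) (fun y => if y < n then m + y else y - n).
Proof.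
split=> [y|i j]; first by repeat case_if; lia.
rewrite (isf_rswap n m).2; have := ltn_ord i; have := ltn_ord j.
by repeat case_if; lia.
Qed.

Lemma rtens_swap n m n' m' (R : relation n m) (S : relation n' m') :
  rcomp (rtens S R) (rswap n n') = rcomp (rswap m m') (rtens R S).
Proof.
apply: relP => i j.
rewrite (in_rcomp_isf _ (isf_rswap n n')) (in_rcomp_isb _ (isb_rswap m m')).
set a := Ordinal _; set b := Ordinal _.
have : b = (if j < m then m' + j else j - m) :> nat by [].
have : a = (if i < n' then n + i else i - n') :> nat by [].
move: a b => a b.
case: (split_ordP i) => x ->; case: (split_ordP j) => y ->;
  case: (split_ordP a) => x' ->; case: (split_ordP b) => y' -> /=;
  have := ltn_ord x; have := ltn_ord x'; have := ltn_ord y;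
  have := ltn_ord y' => ? ? ? ? ? ?; rewrite !in_rtens //;
  solve [lia | apply: mem_rel; lia].
Qed.

Lemma codiag_nat n m (R : relation n m) :
  rcomp R (rcodiag n) = rcomp (rcodiag m) (rtens R R).
Proof.
have in_codl p (x y : 'I_p) : ((lshift p x, y) \in rcodiag p) = (x == y).
  by rewrite inE /= (unsplitK (inl _)) eq_sym.
have in_codr p (x y : 'I_p) : ((rshift p x, y) \in rcodiag p) = (x == y).
  by rewrite inE /= (unsplitK (inr _)) eq_sym.
apply: relP => i j; apply/in_rcompP/in_rcompP => -[k].
  case: (split_ordP i) => x ->; rewrite ?in_codl ?in_codr => /eqP <- Rxj.
    by exists (lshift _ j); rewrite ?in_rtens ?in_codl.
  by exists (rshift _ j); rewrite ?in_rtens ?in_codr.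
case: (split_ordP i) => x ->; case: (split_ordP k) => y ->;
  rewrite in_rtens // ?in_codl ?in_codr => Rxy /eqP <-;
  by exists x; rewrite ?in_codl ?in_codr.
Qed.

Lemma in_epsl n (i : 'I_n) (j : 'I_n) :
  ((lift ord_max i, j) \in rid n.+1 n) = (i == j).
Proof. by rewrite inE /= bump_ord. Qed.

Lemma in_epsm n (j : 'I_n) : ((ord_max, j) \in rid n.+1 n) = false.
Proof. by rewrite inE /= gtn_eqF. Qed.

Lemma eps_nat n m (R : relation n m) :
  rcomp R (rid n.+1 n) = rcomp (rid m.+1 m) (rL R).
Proof.
apply: relP => i j; apply/in_rcompP/in_rcompP => -[k];
  case: (unliftP ord_max i) => [x|] ->.
- rewrite in_epsl => /eqP <- H.
  by exists (lift ord_max j); rewrite ?in_rL ?in_epsl.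
- by rewrite in_epsm.
- case: (unliftP ord_max k) => [y|] ->; rewrite in_rL // in_epsl => H /eqP <-.
  by exists x; rewrite ?in_epsl.
- by case: (unliftP ord_max k) => [y|] ->; rewrite in_rL // in_epsm.
Qed.

Lemma delta_nat n m (R : relation n m) :
  rcomp (rL (rL R)) (rdelta n) = rcomp (rdelta m) (rL R).
Proof.
have topE p (x : 'I_p.+1) : x = p :> nat -> x = ord_max.
  by move=> E; apply: val_inj.
have minE p (x : 'I_p.+1) : minn x p = x.
  by apply/minn_idPl; rewrite -ltnS.
apply: relP => i j; rewrite (in_rcomp_isb _ (isb_rdelta m)).
set b := Ordinal _; have : b = minn j m :> nat by [].
move: b => b.
case: (unliftP ord_max j) => [y|] -> /=; rewrite ?bump_ord => Eb.
  have -> : ((i, b) \in rL R) = ((i, y) \in rL R).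
    by apply: mem_rel; rewrite ?Eb ?minE.
  apply/in_rcompP/idP => [[k]|H].
    rewrite in_rdelta; case: (unliftP ord_max k) => [z|] ->;
      rewrite in_rL //= bump_ord => /eqP Ei.
    by rewrite (@mem_rel _ _ _ i z y y) // Ei minE.
  by exists (lift ord_max i); rewrite ?in_rL // in_rdelta /= bump_ord minE.
have top k : minn k.+1 k = k by apply/minn_idPr.
have -> : b = ord_max by apply: topE; rewrite Eb top.
apply/in_rcompP/idP => [[k]|].
  rewrite in_rdelta; case: (unliftP ord_max k) => [z|] ->;
    rewrite in_rL //= => /eqP Ei _.
  by have -> : i = ord_max; [apply: topE; rewrite Ei top | rewrite in_rL].
case: (unliftP ord_max i) => [x|] ->; rewrite in_rL // => _.
by exists ord_max; rewrite ?in_rL // in_rdelta /= top.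
Qed.

Lemma Garr_eq (P : Type) (A B : obj P) (f g : arr A B) :
  f ≡ g -> Garr f = Garr g.
Proof.
elim=> {A B f g}; try by move=> *; solve_graph.
all: try by move=> *; solve_cograph.
- by [].
- by [].
- by move=> A B f g h _ -> _ ->.
- by move=> A B C g g' f f' _ /= -> _ ->.
- by move=> A A' B B' f f' g g' _ /= -> _ ->.
- by move=> A B f f' _ /= ->.
- by move=> A B f; apply: rcomp_idl.
- by move=> A B f; apply: rcomp_idr.
- by move=> A B C D h g f; apply: rcompA.
- by move=> *; apply: rtens_comp.
- by move=> *; apply: rL_comp.
- move=> A A' B B' C C' f g h /=; apply: relP => i j.
  have le : Gob C + (Gob B + Gob A) <= Gob C + Gob B + Gob A by lia.
  have ge : Gob C' + Gob B' + Gob A' <= Gob C' + (Gob B' + Gob A') by lia.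
  rewrite (in_rcomp_isf _ (isf_rid le)) (in_rcomp_isb _ (isb_rid ge)).
  exact: in_rtensA.
- move=> A B f /=; apply: relP => i j.
  have le : Gob A + 0 <= Gob A by lia.
  have ge : Gob B <= Gob B + 0 by lia.
  rewrite (in_rcomp_isf _ (isf_rid le)) (in_rcomp_isb _ (isb_rid ge)).
  exact/esym/in_rtens0.
- move=> A B f /=; apply: relP => i j.
  rewrite (in_rcomp_isf _ (isf_rid (leqnn _))).
  rewrite (in_rcomp_isb _ (isb_rid (leqnn _))).
  exact/esym/in_rtens1.
- by move=> *; apply: rtens_swap.
- by move=> *; apply: codiag_nat.
- by move=> *; apply: eps_nat.
- by move=> *; apply: delta_nat.
- by move=> A f; apply: relP => -[].
Qed.

Definition G (P : Type) : functor (DSco P) Rel :=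
  @Functor (DSco P) Rel (@Gob P) (@Garr P) (@Garr_eq P)
    (fun A => erefl _) (fun A B C g f => erefl _).

(* Main.v *)
From mathcomp Require Import all_boot zify.
From Stdlib Require Import Eqdep Setoid Morphisms.
Require Import Defs.

Set Implicit Arguments.
Unset Strict Implicit.
Unset Printing Implicit Defensive.

Local Open Scope dsarr_scope.

(** Since [A ⊗ B] is a coproduct, an arrow out of it is a pair of arrows out of
    [A] and [B], and [unitO] has a single arrow to each object.  So only arrows
    out of letters and out of objects [LO C] matter, and cut elimination
    ([normal_comp], [all_normal]) brings each of these to a normal form: an
    arrow from a letter is the inclusion of a summand of the target, and an
    arrow [LO C → B] is either
    - [t ∘ eps C], with [t : C → B] normal, or
    - [j ∘ (LA u ∘ delta C)], with [u : LO C → D] normal and [j] the inclusion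
      of a summand [LO D] of [B].
    The second form is composition of [j] with the coKleisli extension of [u],
    and the comonad laws bring a composite of two arrows of this form to this
    form again.

    The relation of an arrow determines its normal form ([normal_inj]).  In the
    relation of [t ∘ eps C] the outermost [L] of the source is related to
    nothing.  In the relation of [j ∘ (LA u ∘ delta C)] it is related to the
    outermost [L] of the summand [LO D] and to occurrences inside that summand
    only.  So the greatest element related to it identifies the summand, hence
    [D] and [j]; injectivity of the relation of [j] then gives back the relation
    of [u], and one concludes by induction.

    The letters form an arbitrary type, so passing from an equality of pairs
    (source, arrow) to an equality of arrows uses uniqueness of identity
    proofs. *)

(** * Rewriting modulo equality of arrows *)

#[local] Existing Instance eqA_equiv.
#[local] Hint Resolve eqA_refl : core.

#[local] Instance compA_proper P (A B C : obj P) :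
  Proper (@eqA P B C ==> @eqA P A B ==> @eqA P A C) (@compA P A B C).
Proof. by move=> g g' Hg f f' Hf; apply: eq_compA. Qed.

#[local] Instance tensA_proper P (A A' B B' : obj P) :
  Proper (@eqA P A A' ==> @eqA P B B' ==> @eqA P _ _) (@tensA P A A' B B').
Proof. by move=> g g' Hg f f' Hf; apply: eq_tensA. Qed.

#[local] Instance LA_proper P (A B : obj P) :
  Proper (@eqA P A B ==> @eqA P _ _) (@LA P A B).
Proof. by move=> g g' Hg; apply: eq_LA. Qed.

#[local] Arguments inj1 {P} A B : simpl never.
#[local] Arguments inj2 {P} A B : simpl never.

(** * Coproducts *)

Section Coproducts.

Variable P : Type.
Implicit Types A B C D : obj P.

Lemma tens_inj1 A A' B B' (f : arr A A') (g : arr B B') :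
  (f ⊗ g) ∘ inj1 A B ≡ inj1 A' B' ∘ f.
Proof.
have nat_runitV : runitV A' ∘ f ≡ (f ⊗ idA unitO) ∘ runitV A.
  rewrite -(eq_idr (runitV A' ∘ f)) -(eq_runitVK A) -eq_assoc.
  by rewrite (eq_assoc f) nat_runit !eq_assoc eq_runitK eq_idl.
rewrite /inj1 -eq_assoc nat_runitV !eq_assoc -!eq_tens_comp !eq_idl !eq_idr.
by rewrite (eq_initA (g ∘ _)).
Qed.

Lemma tens_inj2 A A' B B' (f : arr A A') (g : arr B B') :
  (f ⊗ g) ∘ inj2 A B ≡ inj2 A' B' ∘ g.
Proof.
have nat_lunitV : lunitV B' ∘ g ≡ (idA unitO ⊗ g) ∘ lunitV B.
  rewrite -(eq_idr (lunitV B' ∘ g)) -(eq_lunitVK B) -eq_assoc.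
  by rewrite (eq_assoc g) nat_lunit !eq_assoc eq_lunitK eq_idl.
rewrite /inj2 -eq_assoc nat_lunitV !eq_assoc -!eq_tens_comp !eq_idl !eq_idr.
by rewrite (eq_initA (f ∘ _)).
Qed.

Definition copair A B C (f : arr A C) (g : arr B C) : arr (A ⊗ B) C :=
  codiag C ∘ (f ⊗ g).

Lemma copair_inj1 A B C (f : arr A C) (g : arr B C) : copair f g ∘ inj1 A B ≡ f.
Proof.
by rewrite /copair -eq_assoc tens_inj1 eq_assoc eq_codiag_inj1 eq_idl.
Qed.

Lemma copair_inj2 A B C (f : arr A C) (g : arr B C) : copair f g ∘ inj2 A B ≡ g.
Proof.
by rewrite /copair -eq_assoc tens_inj2 eq_assoc eq_codiag_inj2 eq_idl.
Qed.

Lemma copair_eta A B C (f : arr (A ⊗ B) C) :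
  f ≡ copair (f ∘ inj1 A B) (f ∘ inj2 A B).
Proof.
by rewrite /copair eq_tens_comp eq_assoc -nat_codiag -eq_assoc eq_codiag_inj eq_idr.
Qed.

Lemma assoc_copair A B C :
  assoc A B C ≡ copair (copair (inj1 _ _) (inj2 A (B ⊗ C) ∘ inj1 B C))
                       (inj2 A (B ⊗ C) ∘ inj2 B C).
Proof. exact: eq_assoc_canonical. Qed.

Lemma assocV_inj1 A B C : assocV A B C ∘ inj1 A (B ⊗ C) ≡ inj1 _ C ∘ inj1 A B.
Proof.
have E : inj1 A (B ⊗ C) ≡ assoc A B C ∘ (inj1 _ C ∘ inj1 A B).
  by rewrite assoc_copair eq_assoc !copair_inj1.
by rewrite E eq_assoc eq_assocK eq_idl.
Qed.

Lemma assocV_inj21 A B C :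
  assocV A B C ∘ inj2 A (B ⊗ C) ∘ inj1 B C ≡ inj1 _ C ∘ inj2 A B.
Proof.
have E : inj2 A (B ⊗ C) ∘ inj1 B C ≡ assoc A B C ∘ (inj1 _ C ∘ inj2 A B).
  by rewrite assoc_copair eq_assoc copair_inj1 copair_inj2.
by rewrite -eq_assoc E eq_assoc eq_assocK eq_idl.
Qed.

Lemma assocV_inj22 A B C : assocV A B C ∘ inj2 A (B ⊗ C) ∘ inj2 B C ≡ inj2 _ C.
Proof.
have E : inj2 A (B ⊗ C) ∘ inj2 B C ≡ assoc A B C ∘ inj2 _ C.
  by rewrite assoc_copair copair_inj2.
by rewrite -eq_assoc E eq_assoc eq_assocK eq_idl.
Qed.

Lemma lunitV_inj2 A : lunitV A ≡ inj2 unitO A.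
Proof. by rewrite /inj2 -(eq_initA (idA unitO)) eq_tens_id eq_idl. Qed.

Lemma runitV_inj1 A : runitV A ≡ inj1 A unitO.
Proof. by rewrite /inj1 -(eq_initA (idA unitO)) eq_tens_id eq_idl. Qed.

End Coproducts.

(** * Normal forms *)

Section NormalForms.

Variable P : Type.
Implicit Types A B C D X : obj P.

(** Indexes the letters and objects [LO D] of which [B] is an iterated
    coproduct: the occurrences of letters and of [L] in [B] that are not in the
    scope of an [L]. *)
Fixpoint summand B : Type :=
  match B with
  | unitO => False
  | tensO A B => (summand A + summand B)%type
  | _ => unit
  end.

Fixpoint embed B : summand B -> {X : obj P & arr X B} :=
  match B with
  | unitO => fun x => match x with end
  | tensO A B => fun x =>
      match x with
      | inl y => existT _ _ (inj1 A B ∘ projT2 (embed y))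
      | inr y => existT _ _ (inj2 A B ∘ projT2 (embed y))
      end
  | B => fun _ => existT _ B (idA B)
  end.

Inductive embedding X B : arr X B -> Prop :=
  | Embedding (x : summand B) j : embed x = existT _ X j -> embedding j.

Lemma embedding_inj1 X A B (j : arr X A) :
  embedding j -> embedding (inj1 A B ∘ j).
Proof. by case=> x {}j E; exists (inl x) => /=; rewrite E. Qed.

Lemma embedding_inj2 X A B (j : arr X B) :
  embedding j -> embedding (inj2 A B ∘ j).
Proof. by case=> x {}j E; exists (inr x) => /=; rewrite E. Qed.

(** Normal arrows out of [LO C], where [N] is normality of arrows out of [C].
    Making [N] a parameter lets [normal] be defined by recursion on the source,
    which spares inversions on indices in [obj P]. *)
Inductive Lnormal C (N : forall B, arr C B -> Prop) :
    forall B, arr (LO C) B -> Prop :=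
  | Lnormal_eps B (f : arr (LO C) B) t :
      N B t -> f ≡ t ∘ eps C -> Lnormal N f
  | Lnormal_delta B (f : arr (LO C) B) D (u : arr (LO C) D) j :
      Lnormal N u -> embedding j -> f ≡ j ∘ (LA u ∘ delta C) -> Lnormal N f.

Fixpoint normal A : forall B, arr A B -> Prop :=
  match A with
  | letter p => fun B f => exists2 j : arr (letter p) B, embedding j & f ≡ j
  | unitO => fun _ _ => True
  | tensO A1 A2 => fun B f => normal (f ∘ inj1 A1 A2) /\ normal (f ∘ inj2 A1 A2)
  | LO C => Lnormal (@normal C)
  end.

Lemma normal_eqA A B (f g : arr A B) : f ≡ g -> normal f -> normal g.
Proof.
elim: A B f g => [p|| A1 IH1 A2 IH2|C _] B f g E //=.
- by case=> j Hj Ef; exists j => //; rewrite -E.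
- by case=> [N1 N2]; split; [apply: IH1 N1 | apply: IH2 N2]; rewrite E.
- move=> N; case: N g E => {f} {}B f.
    by move=> t Nt Ef g E; apply: Lnormal_eps Nt _; rewrite -E.
  by move=> D u j Nu Hj Ef g E; apply: Lnormal_delta Nu Hj _; rewrite -E.
Qed.

#[local] Instance normal_proper A B : Proper (@eqA P A B ==> iff) (@normal A B).
Proof. by move=> f g E; split; apply: normal_eqA; rewrite ?E. Qed.

Lemma normal_comp_embedding X B E (g : arr B E) (j : arr X B) :
  embedding j -> normal g -> normal (g ∘ j).
Proof.
case=> x {}j Ex.
suff H : normal g -> normal (g ∘ projT2 (embed x)) by rewrite Ex in H.
elim: B g x {j Ex} => [p||B1 IH1 B2 IH2|D _] g.
- by move=> x Ng; apply: normal_eqA (eqA_sym (eq_idr g)) Ng.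
- by case.
- by case=> x [N1 N2] /=; rewrite eq_assoc; [apply: IH1 | apply: IH2].
- by move=> x Ng; apply: normal_eqA (eqA_sym (eq_idr g)) Ng.
Qed.

(** Postcomposing with a coproduct injection only changes the inclusions at the
    target end of a normal form. *)
Lemma normal_postcomp A B B' (i : arr B B') (f : arr A B) :
  (forall X (j : arr X B), embedding j -> embedding (i ∘ j)) ->
  normal f -> normal (i ∘ f).
Proof.
move=> Hi; elim: A B i Hi f => [p||A1 IH1 A2 IH2|C IH] B i Hi f //=.
- by case=> j Hj Ef; exists (i ∘ j); [exact: Hi | rewrite Ef].
- by case=> [N1 N2]; split; rewrite -eq_assoc; [apply: IH1|apply: IH2].
- move=> N; case: N i Hi => {f} {}B f.
    move=> t Nt Ef i Hi; apply: (@Lnormal_eps _ _ _ _ (i ∘ t)); first exact: IH.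
    by rewrite Ef eq_assoc.
  move=> D u j Nu Hj Ef i Hi; apply: Lnormal_delta Nu (Hi _ _ Hj) _.
  by rewrite Ef eq_assoc.
Qed.

Lemma normal_inj1_comp A B B' (f : arr A B) :
  normal f -> normal (inj1 B B' ∘ f).
Proof. by apply: normal_postcomp => X j; apply: embedding_inj1. Qed.

Lemma normal_inj2_comp A B B' (f : arr A B') :
  normal f -> normal (inj2 B B' ∘ f).
Proof. by apply: normal_postcomp => X j; apply: embedding_inj2. Qed.

Lemma normal_LA_delta C D (u : arr (LO C) D) :
  normal u -> normal (LA u ∘ delta C).
Proof.
move=> Nu; apply: (Lnormal_delta (j := idA (LO D)) Nu); last by rewrite eq_idl.
by exists tt.
Qed.

Lemma normal_comp_eps C B (t : arr C B) : normal t -> normal (t ∘ eps C).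
Proof. by move=> Nt; apply: Lnormal_eps Nt _. Qed.

(** Cut elimination.  The interesting case is [g ∘ (LA u ∘ delta C)] with [g]
    normal out of [LO D]:
    - if [g] is [t ∘ eps D], naturality of [eps] and the counit law give
      [t ∘ u], a composition with the smaller arrow [u];
    - if [g] is [k ∘ (LA v ∘ delta D)], naturality and coassociativity of
      [delta] give [k ∘ (LA (v ∘ (LA u ∘ delta C)) ∘ delta C)], with [v]
      smaller than [g].
    Hence three nested inductions: on [A], on [f] and on [g]. *)
Lemma normal_comp A B E (g : arr B E) (f : arr A B) :
  normal g -> normal f -> normal (g ∘ f).
Proof.
elim: A B E g f => [p||A1 IH1 A2 IH2|C IH] B E g f Ng //=.
- case=> j Hj Ef; apply: (normal_eqA (A := letter p) (f := g ∘ j)).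
    by rewrite Ef.
  exact: normal_comp_embedding.
- by case=> [N1 N2]; split; rewrite -eq_assoc; [apply: IH1|apply: IH2].
move=> Nf; elim: Nf E g Ng => {f} {}B f.
  move=> t Nt Ef E g Ng; apply: (normal_eqA (A := LO C) (f := (g ∘ t) ∘ eps C)).
    by rewrite Ef eq_assoc.
  by apply: normal_comp_eps; apply: IH.
move=> D u j Nu IHu Hj Ef E g Ng.
apply: (normal_eqA (A := LO C) (f := (g ∘ j) ∘ (LA u ∘ delta C))).
  by rewrite Ef !eq_assoc.
(* The inclusion [j] is absorbed into [g], which now starts from [LO D]. *)
have := normal_comp_embedding Hj Ng.
move: (g ∘ j) => {f j Hj Ef Ng} g; elim=>
  {E g} [E g t Nt Eg|E g D' v k Nv IHv Hk Eg].
  apply: (normal_eqA (A := LO C) (f := t ∘ u)); last exact: IHu.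
  rewrite Eg -eq_assoc (eq_assoc (eps D)) -nat_eps -!eq_assoc eq_eps_delta.
  by rewrite eq_idr.
apply: (Lnormal_delta IHv Hk).
rewrite Eg -!eq_assoc (eq_assoc (delta D)) -nat_delta.
rewrite -(eq_assoc (LA (LA u))) eq_delta_delta (eq_assoc (LA (LA u))) -eq_L_comp.
by rewrite (eq_assoc (LA v)) -eq_L_comp.
Qed.

Lemma normal_id A : normal (idA A).
Proof.
elim: A => [p||A IHA B IHB|C IH] //=.
- by exists (idA _) => //; exists tt.
- split; rewrite eq_idl.
    by rewrite -(eq_idr (inj1 A B)); apply: normal_inj1_comp.
  by rewrite -(eq_idr (inj2 A B)); apply: normal_inj2_comp.
apply: (normal_eqA (eq_Leps_delta C)); apply: normal_LA_delta.
by rewrite -(eq_idl (eps C)); apply: normal_comp_eps.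
Qed.

Lemma normal_inj1 A B : normal (inj1 A B).
Proof. by have [] := normal_id (A ⊗ B); rewrite eq_idl. Qed.

Lemma normal_inj2 A B : normal (inj2 A B).
Proof. by have [] := normal_id (A ⊗ B); rewrite !eq_idl. Qed.

Lemma normal_copair A B C (f : arr A C) (g : arr B C) :
  normal f -> normal g -> normal (copair f g).
Proof. by move=> Nf Ng; split; rewrite ?copair_inj1 ?copair_inj2. Qed.

Lemma normal_LA A B (f : arr A B) : normal f -> normal (LA f).
Proof.
move=> Nf; have -> : LA f ≡ LA (f ∘ eps A) ∘ delta A.
  by rewrite eq_L_comp -eq_assoc eq_Leps_delta eq_idr.
exact/normal_LA_delta/normal_comp_eps.
Qed.

Lemma all_normal A B (f : arr A B) : normal f.
Proof.
have N1 := normal_inj1; have N2 := normal_inj2; have Nid := normal_id.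
elim: f => {A B} //.
- by move=> *; apply: normal_comp.
- move=> A A' B B' f Nf g Ng; split; rewrite ?tens_inj1 ?tens_inj2.
    exact: normal_inj1_comp.
  exact: normal_inj2_comp.
- by move=> *; apply: normal_LA.
- move=> A B C; rewrite assoc_copair.
  by do ![apply: normal_copair|apply: normal_inj2_comp].
- move=> A B C; split; first by rewrite assocV_inj1; apply: normal_inj1_comp.
  split; last by rewrite assocV_inj22.
  by rewrite assocV_inj21; apply: normal_inj1_comp.
- by move=> A; rewrite eq_lunit_canonical; apply: normal_copair.
- by move=> A; rewrite lunitV_inj2.
- by move=> A; rewrite eq_runit_canonical; apply: normal_copair.
- by move=> A; rewrite runitV_inj1.
- by move=> A B; rewrite eq_swap_canonical; apply: normal_copair.
- by move=> A; split; rewrite ?eq_codiag_inj1 ?eq_codiag_inj2.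
- by move=> A; rewrite -(eq_idl (eps A)); apply: normal_comp_eps.
- move=> A; rewrite -(eq_idl (delta A)) -(eq_L_id (LO A)); exact: normal_LA_delta.
- by move=> A B; rewrite eq_psi; apply: normal_copair; apply: normal_LA.
Qed.

End NormalForms.

(** * Relations of the normal forms *)

Lemma isf_inj_cancel n m k (S : relation m k) phi (R R' : relation n m) :
  isf S phi -> (forall x y, phi x = phi y -> x = y) ->
  rcomp S R = rcomp S R' -> R = R'.
Proof.
move=> HS inj_phi E; apply: relP => i j.
pose l := Ordinal (HS.1 j (ltn_ord j)).
have mem Q : ((i, l) \in rcomp S Q) = ((i, j) \in Q).
  apply/in_rcompP/idP => [[j' Qj']|Qj]; last by exists j; rewrite ?HS.2.
  by rewrite HS.2 => /eqP/inj_phi/val_inj ->.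
by rewrite -!mem E.
Qed.

(** [rcomp (rL R) (rdelta n)] is the relation of [LA u ∘ delta C] when [R] is
    that of [u]: it is [R] with one more pair, made of the greatest elements. *)
Lemma in_rL_rdelta_lift n m (R : relation n.+1 m) i j :
  ((i, lift ord_max j) \in rcomp (rL R) (rdelta n)) = ((i, j) \in R).
Proof.
have minE (x : 'I_n.+1) : minn x n = x by apply/minn_idPl; rewrite -ltnS.
apply/in_rcompP/idP => [[k]|Rij].
  rewrite in_rdelta; case: (unliftP ord_max k) => [z|] ->; rewrite in_rL //=.
  rewrite bump_ord minE => /eqP Ei Rzj.
  by rewrite (@mem_rel _ _ _ i z j j).
by exists (lift ord_max i); rewrite ?in_rL // in_rdelta /= bump_ord minE.
Qed.

Lemma rL_rdelta_max n m (R : relation n.+1 m) :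
  (ord_max, ord_max) \in rcomp (rL R) (rdelta n).
Proof.
by apply/in_rcompP; exists ord_max; rewrite ?in_rL // in_rdelta /=; lia.
Qed.

Lemma rcomp_eps_max n m (R : relation n m) j :
  ((ord_max, j) \in rcomp R (rid n.+1 n)) = false.
Proof. by apply/in_rcompP => -[k]; rewrite in_epsm. Qed.

Lemma rcomp_eps_inj n m (R R' : relation n m) :
  rcomp R (rid n.+1 n) = rcomp R' (rid n.+1 n) -> R = R'.
Proof.
have mem Q i j :
    ((lift ord_max i, j) \in rcomp Q (rid n.+1 n)) = ((i, j) \in Q).
  apply/in_rcompP/idP => [[k]|Qij]; first by rewrite in_epsl => /eqP <-.
  by exists i; rewrite ?in_epsl.
by move=> E; apply: relP => i j; rewrite -!mem E.
Qed.

Lemma rL_rdelta_inj n m (R R' : relation n.+1 m) :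
  rcomp (rL R) (rdelta n) = rcomp (rL R') (rdelta n) -> R = R'.
Proof.
by move=> E; apply: relP => i j; rewrite -(in_rL_rdelta_lift R) E in_rL_rdelta_lift.
Qed.

Section Relations.

Variable P : Type.
Implicit Types A B C D X : obj P.

(** The greatest of the elements of [Gob B] that lie in the given summand. *)
Fixpoint top B : summand B -> nat :=
  match B with
  | letter _ => fun _ => 0
  | unitO => fun _ => 0
  | tensO A B => fun x =>
      match x with inl y => Gob B + top y | inr y => top y end
  | LO C => fun _ => Gob C
  end.

Lemma top_lt B (x : summand B) : top x < Gob B.
Proof.
by elim: B x => [p||A IHA B IHB|C _] //= [] x;
  [have := IHA x|have := IHB x]; lia.
Qed.

Lemma top_inj B : injective (@top B).
Proof.
elim: B => [p [] []|[]|A IHA B IHB|C _ [] []] //=.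
by move=> [] x [] y /= E; have := top_lt x; have := top_lt y => ? ?;
  try lia; congr (_ _); [apply: IHA | apply: IHB]; lia.
Qed.

(** The elements of a summand form an interval of [Gob B] ending at [top x], so
    the relation of its inclusion is a shift. *)
Lemma isf_embed B (x : summand B) (X := projT1 (embed x)) :
  Gob X <= (top x).+1 /\
  isf (Garr (projT2 (embed x))) (fun i => (top x).+1 - Gob X + i).
Proof.
have isf_ext n m (R : relation n m) phi chi :
    isf R phi -> phi =1 chi -> isf R chi.
  by move=> [H1 H2] E; split=> [i|i j]; rewrite -E //; apply: H1.
rewrite {}/X; elim: B x => [p||A IHA B IHB|C _] //=.
- move=> _; split=> //; apply: isf_ext (isf_rid _) _ => // i; lia.
- case=> x /=; [have [le H] := IHA x|have [le H] := IHB x];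
    (split; first lia).
    by apply: isf_ext (isf_comp (isf_inj1 A B) H) _ => i /=; lia.
  by apply: isf_ext (isf_comp (isf_inj2 A B) H) _ => i.
- move=> _; split=> //; apply: isf_ext (isf_rid _) _ => // i; lia.
Qed.

(** The outermost [L] of the source remembers which summand of the target the
    arrow factors through. *)
Lemma embed_L_top B D (x : summand B) (j : arr (LO D) B) n
    (R : relation n.+1 (Gob D)) :
  embed x = existT _ _ j ->
  let S := rcomp (Garr j) (rcomp (rL R) (rdelta n)) in
  (exists2 k : 'I_(Gob B), (ord_max, k) \in S & k = top x :> nat) /\
  (forall k, (ord_max, k) \in S -> k <= top x).
Proof.
move=> Ex S; have := isf_embed x; rewrite Ex /= => -[le [H1 H2]].
split.
  exists (Ordinal (top_lt x)) => //; apply/in_rcompP.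
  exists (@ord_max (Gob D)); first exact: rL_rdelta_max.
  by rewrite H2 /=; lia.
move=> k /in_rcompP[[l lt_l] _]; have lt_l' : l < (Gob D).+1 by [].
by rewrite H2 => /eqP ->; rewrite -ltnS /=; lia.
Qed.

Lemma normal_inj A B (f g : arr A B) :
  normal f -> normal g -> Garr f = Garr g -> f ≡ g.
Proof.
elim: A B f g => [p||A1 IH1 A2 IH2|C IH] B f g.
(* The letter has the single element [ord0], sent to [top x] and [top y]. *)
- move=> [_ [x j Ex] Ef] [_ [y k Ey] Eg].
  rewrite (Garr_eq Ef) (Garr_eq Eg) Ef Eg => E.
  have := isf_embed x; rewrite Ex => -[_ /= [H1 H2]].
  have := isf_embed y; rewrite Ey => -[_ /= [K1 K2]].
  have Exy : x = y.
    apply: top_inj; have := H2 ord0 (Ordinal (top_lt x)).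
    by rewrite E K2 /=; lia.
  by subst y; rewrite Ex in Ey; rewrite (inj_pair2 _ _ _ _ _ Ey).
- by move=> _ _ _; rewrite (eq_initA f) (eq_initA g).
- move=> [Nf1 Nf2] [Ng1 Ng2] E; rewrite (copair_eta f) (copair_eta g) /copair.
  by rewrite (IH1 _ _ _ Nf1 Ng1) ?(IH2 _ _ _ Nf2 Ng2) //= E.
move=> Nf; elim: Nf g => {B f} [B f t Nt Ef|B f D u j Nu IHu [x {}j Ex] Ef] g.
  move=> Ng; case: Ng t Nt f Ef =>
    {B g} [B g t' Nt' Eg|B g D' u' j' _ [y {}j' Ey] Eg] t Nt f Ef;
    rewrite (Garr_eq Ef) (Garr_eq Eg) Ef Eg /= => E.
    by rewrite (IH _ _ _ Nt Nt') //; apply: rcomp_eps_inj.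
  have [[k]] := embed_L_top (Garr u') Ey.
  by rewrite -E rcomp_eps_max.
move=> Ng; case: Ng f j x Ex Ef =>
  {B g} [B g t' Nt' Eg|B g D' u' j' Nu' [y {}j' Ey] Eg] f j x Ex Ef;
  rewrite (Garr_eq Ef) (Garr_eq Eg) Ef Eg /= => E.
  have [[k]] := embed_L_top (Garr u) Ex.
  by rewrite E rcomp_eps_max.
have Exy : x = y.
  have [[k Hk Ek] Hx] := embed_L_top (Garr u) Ex.
  have [[l Hl El] Hy] := embed_L_top (Garr u') Ey.
  rewrite E in Hk Hx; have := Hy _ Hk; have := Hx _ Hl; rewrite Ek El => ? ?.
  by apply: top_inj; lia.
(* This step needs unique identity proofs in [obj P]. *)
subst y; rewrite Ex in Ey; have [ED] := EqdepFacts.eq_sigT_fst Ey.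
subst D'; have Ej := inj_pair2 _ _ _ _ _ Ey; subst j'.
rewrite (IHu _ Nu') //; apply: rL_rdelta_inj.
have := isf_embed x; rewrite Ex => -[_ /= Hj].
by apply: (isf_inj_cancel Hj) E => a b; lia.
Qed.

End Relations.

Theorem mainTheorem11 (P : Type) : faithful (G P).
Proof. move=> A B f g; apply: normal_inj; exact: all_normal. Qed.
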